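(* Let $S$ be a semigroup and $(A,\cdot)$ a unitary, nonsingular and strong right partial $S$-act. Then: (1) The global $S$-act $(A^S,* )$ is an $A$-generated globalization of $(A,\cdot)$ via the map $\lambda\colon A\to A^S$ given by $a\mapsto f_{b,s}$ where $a=b\cdot s$ with $b\in A$, $s\in S$. (2) If a global $S$-act $(B,\circ)$ is an $A$-generated globalization of $(A,\cdot)$ via a map $\iota\colon A\to B$, then there is a unique morphism of global $S$-acts $\varphi\colon B\to A^S$ such that $\lambda=\varphi\iota$.
   Context: A partial map $f\colon X\to Y$ is a map $Z\to Y$ with $Z\subseteq X$, $Z=\mathrm{dom}(f)$; $f(x)$ is defined iff $x\in Z$; two partial maps are equal iff they have the same domain and the same values. Let $S$ be a semigroup. All actions are right actions. A global action of $S$ on a set $B$ is a map $*\colon B\times S\to B$ with $(b*s)*t=b*(st)$; then $(B,* )$ is a global $S$-act. A partial action of $S$ on a set $A$ is a partial map $\cdot\colon A\times S\to A$ such that if $a\cdot s$ and $(a\cdot s)\cdot t$ are defined, then $a\cdot st$ is defined and $(a\cdot s)\cdot t=a\cdot st$; then $(A,\cdot)$ is a partial $S$-act. It is strong if whenever $a\cdot s$ and $a\cdot st$ are defined, $(a\cdot s)\cdot t$ is defined and $(a\cdot s)\cdot t=a\cdot st$. It is unitary if for each $a\in A$ there are $b\in A$, $s\in S$ such that $b\cdot s$ is defined and $a=b\cdot s$. For $a\in A$, $s\in S$ let $f_{a,s}\colon S\to A$ be the partial map with $\mathrm{dom}(f_{a,s})=\{t\in S: a\cdot st\text{ is defined}\}$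 and $f_{a,s}(t)=a\cdot st$ for $t$ in this domain. Put $A^S=\{f_{a,s}: a\in A,s\in S\}$. For a partial map $f\colon S\to A$ and $s\in S$, $f*s$ is the partial map with $\mathrm{dom}(f*s)=\{t\in S: st\in\mathrm{dom}(f)\}$ and $(f*s)(t)=f(st)$. If $\cdot$ is strong, $*$ restricts to a global action of $S$ on $A^S$, and $f_{a,s}*t=f_{a,st}$. $(A,\cdot)$ is nonsingular if whenever $f_{a,s}=f_{b,t}$ and $a\cdot s$ is defined, then $b\cdot t$ is defined and $a\cdot s=b\cdot t$. If $\cdot$ is unitary and strong, $\lambda$ is well defined (independent of the choice of $b,s$). A globalization of $(A,\cdot)$ is a global $S$-act $(B,* )$ together with an injective map $\iota\colon A\to B$ such that for all $a\in A,s\in S$: (G1) $a\cdot s$ is defined iff $\iota(a)*s\in\iota(A)$; (G2) if $a\cdot s$ is defined then $\iota(a\cdot s)=\iota(a)*s$. One says $(B,* )$ is a globalization of $(A,\cdot)$ via $\iota$. It is $A$-generated if every $b\in B$ equals $\iota(a)*s$ for some $a\in A$, $s\in S$. A morphism of global $S$-acts $(B,* )\to(C,\circ)$ is a map $\varphi$ with $\varphi(b*s)=\varphi(b)\circ s$ for all $b\in B$, $s\in S$. *)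

(* Defs.v *)
From HB Require Import structures.
From mathcomp Require Import all_boot monoid.
From mathcomp Require Import boolp classical_sets.

Set Implicit Arguments.
Unset Strict Implicit.
Unset Printing Implicit Defensive.

Local Open Scope group_scope.

(* A partial map X -> Y is encoded as a function X -> option Y, undefined where
   its value is None.  By functional extensionality, Leibniz equality of such
   functions is equality of domains and of values. *)

Section Acts.
Variable S : semigroupType.

Definition global_action (B : Type) (op : B -> S -> B) : Prop :=
  forall b s t, op (op b s) t = op b (s * t).

Definition act_morphism (B C : Type) (opB : B -> S -> B) (opC : C -> S -> C)
    (phi : B -> C) : Prop :=
  forall b s, phi (opB b s) = opC (phi b) s.

(* (f * s)(t) = f(st) *)
Definition pmap_act (A : Type) (f : S -> option A) (s : S) : S -> option A :=
  fun t => f (s * t).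

Section PartialAct.
Variables (A : Type) (dot : A -> S -> option A).

Definition partial_action : Prop :=
  forall a s b t c,
    dot a s = Some b -> dot b t = Some c -> dot a (s * t) = Some c.

Definition strong : Prop :=
  forall a s t b c,
    dot a s = Some b -> dot a (s * t) = Some c -> dot b t = Some c.

Definition unitary : Prop := forall a, exists b s, dot b s = Some a.

Definition fpmap (a : A) (s : S) : S -> option A := fun t => dot a (s * t).

Definition nonsingular : Prop :=
  forall a b s t c,
    fpmap a s = fpmap b t -> dot a s = Some c -> dot b t = Some c.

(* The set A^S of all partial maps f_{a,s}, as a type. *)
Definition AS : Type := {f : S -> option A | exists a s, f = fpmap a s}.

Definition fAS (a : A) (s : S) : AS :=
  exist _ (fpmap a s) (ex_intro _ a (ex_intro _ s erefl)).

Lemma pmap_act_fpmap a s t : pmap_act (fpmap a s) t = fpmap a (s * t).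
Proof. by apply/funext => u; rewrite /pmap_act /fpmap mulgA. Qed.

Lemma AS_act_subproof (f : AS) (t : S) :
  exists a s, pmap_act (sval f) t = fpmap a s.
Proof.
by case: f => _ [a [s /= ->]]; exists a, (s * t); rewrite pmap_act_fpmap.
Qed.

Definition AS_act (f : AS) (t : S) : AS :=
  exist _ (pmap_act (sval f) t) (AS_act_subproof f t).

(* lambda a = f_{b,s} for a chosen pair (b, s) with a = b . s; by lambdaE the
   choice is irrelevant when the partial action is strong. *)
Definition lambda (hU : unitary) (a : A) : AS :=
  let: exist b hb := cid (hU a) in fAS b (sval (cid hb)).

Lemma lambdaE (hU : unitary) : partial_action -> strong ->
  forall a b s, dot b s = Some a -> lambda hU a = fAS b s.
Proof.
move=> hP hS.
have fpmapE a b s : dot b s = Some a -> fpmap b s = dot a.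
  move=> bs; apply/funext => t; rewrite /fpmap.
  case bst: (dot b (s * t)) => [c|]; first by rewrite (hS _ _ _ _ _ bs bst).
  case ast: (dot a t) => [c|] //.
  by rewrite (hP _ _ _ _ _ bs ast) in bst.
move=> a b s bs; rewrite /lambda; case: cid => b' hb; case: cid => s' /= bs'.
by apply: eq_exist; rewrite /= (fpmapE _ _ _ bs) (fpmapE _ _ _ bs').
Qed.

Definition globalization (B : Type) (op : B -> S -> B) (iota : A -> B) : Prop :=
  [/\ global_action op,
      injective iota,
      forall a s, isSome (dot a s) <-> range iota (op (iota a) s)
    & forall a s a', dot a s = Some a' -> iota a' = op (iota a) s].

Definition generated (B : Type) (op : B -> S -> B) (iota : A -> B) : Prop :=
  forall b, exists a s, b = op (iota a) s.

End PartialAct.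
End Acts.

Arguments AS_act {S A} dot.

(* Main.v *)
(* By strength f_{b,s}(t) = a . t whenever a = b . s, so lambda a is the partial
   map t |-> a . t and lambda a * s = f_{a,s}.  For any globalization, a . s = c
   iff iota a * s = iota c; hence iota a * s determines f_{a,s}, and sending
   iota a * s to f_{a,s} is the only candidate for the morphism. *)
Require Import Defs.
From mathcomp Require Import all_boot monoid.
From mathcomp Require Import boolp classical_sets.

Set Implicit Arguments.
Unset Strict Implicit.
Unset Printing Implicit Defensive.

Local Open Scope group_scope.

Section PartialAct.
Variables (S : semigroupType) (A : Type) (dot : A -> S -> option A).

Lemma fAS_eq a b s t : fpmap dot a s = fpmap dot b t -> fAS dot a s = fAS dot b t.
Proof. by move=> st; apply: eq_exist. Qed.

Lemma AS_act_fAS a s t : AS_act dot (fAS dot a s) t = fAS dot a (s * t).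
Proof. by apply: eq_exist; rewrite /= pmap_act_fpmap. Qed.

Lemma AS_act_global : global_action (AS_act dot).
Proof.
move=> f s t; apply: eq_exist; apply/funext => u.
by rewrite /= /pmap_act mulgA.
Qed.

(** Strength shows that [dot a] extends [fpmap dot b s], and the partial action law gives the
    converse, so the two domains coincide. *)
Lemma fpmap_dot : partial_action dot -> strong dot ->
  forall a b s, dot b s = Some a -> fpmap dot b s = dot a.
Proof.
move=> hP hS a b s bs; apply/funext => t; rewrite /fpmap.
case bst: (dot b (s * t)) => [c|]; first by rewrite (hS _ _ _ _ _ bs bst).
by case at_: (dot a t) => [c|//]; rewrite (hP _ _ _ _ _ bs at_) in bst.
Qed.

Lemma AS_act_lambda (hU : unitary dot) : partial_action dot -> strong dot ->
  forall a s, AS_act dot (lambda hU a) s = fAS dot a s.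
Proof.
move=> hP hS a s; have [b [t bt]] := hU a.
rewrite (lambdaE hU hP hS bt) AS_act_fAS; apply: fAS_eq.
by rewrite -pmap_act_fpmap (fpmap_dot hP hS bt).
Qed.

(** This is where nonsingularity enters: with [c] written as [b . t], it carries the value [c]
    across [fpmap dot b t = fpmap dot a s]. Injectivity of [lambda] and (G1) both follow. *)
Lemma lambda_eq_fAS (hU : unitary dot) :
  partial_action dot -> strong dot -> nonsingular dot ->
  forall a s c, lambda hU c = fAS dot a s <-> dot a s = Some c.
Proof.
move=> hP hS hN a s c; split; last exact: lambdaE.
have [b [t bt]] := hU c.
by rewrite (lambdaE hU hP hS bt) => /(congr1 sval) /= /hN; apply.
Qed.

Lemma lambda_globalization (hU : unitary dot) :
  partial_action dot -> strong dot -> nonsingular dot ->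
  globalization dot (AS_act dot) (lambda hU).
Proof.
move=> hP hS hN; split.
- exact: AS_act_global.
- move=> a a'; have [b [s bs]] := hU a'.
  (* The hypothesis becomes [dot b s = Some a], to be compared with [bs]. *)
  rewrite (lambdaE hU hP hS bs) => /(lambda_eq_fAS hU hP hS hN).
  by rewrite bs => -[].
- move=> a s; rewrite AS_act_lambda //; split.
    by case as_: (dot a s) => [c|//] _; exists c => //; exact: lambdaE.
  by case=> c _ /(lambda_eq_fAS hU hP hS hN) ->.
- by move=> a s c as_; rewrite AS_act_lambda //; exact: lambdaE.
Qed.

Lemma lambda_generated (hU : unitary dot) : partial_action dot -> strong dot ->
  generated (AS_act dot) (lambda hU).
Proof.
move=> hP hS [f [a [s fE]]]; exists a, s; rewrite AS_act_lambda //.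
exact: eq_exist.
Qed.

(** For the converse, (G1) makes [a . s] defined; (G2) and injectivity of [iota] then identify its
    value. *)
Lemma globalization_dotE (B : Type) (op : B -> S -> B) (iota : A -> B) :
  globalization dot op iota ->
  forall a s c, dot a s = Some c <-> op (iota a) s = iota c.
Proof.
move=> [_ iota_inj G1 G2] a s c; split=> [/G2 //|asc].
have : dot a s by apply/G1; rewrite asc; exists c.
case as_: (dot a s) => [d|//] _; congr Some.
by apply: iota_inj; rewrite (G2 _ _ _ as_).
Qed.

Lemma globalization_fpmap (B : Type) (op : B -> S -> B) (iota : A -> B) :
  globalization dot op iota ->
  forall a b s t, op (iota a) s = op (iota b) t -> fpmap dot a s = fpmap dot b t.
Proof.
move=> hG a b s t st; have [opA _ _ _] := hG.
(* Both sides say that the common element of [B], acted on by [u], is [iota c]. *)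
have E u c : fpmap dot a s u = Some c <-> fpmap dot b t u = Some c.
  by rewrite /fpmap !(globalization_dotE hG) -!opA st.
apply/funext => u; case bu: (fpmap dot b t u) => [c|]; first exact/E.
by case au: (fpmap dot a s u) => [c|//]; move/E: au; rewrite bu.
Qed.

End PartialAct.

Theorem theorem4p7 (S : semigroupType) (A : Type) (dot : A -> S -> option A)
    (hP : partial_action dot) (hU : unitary dot)
    (hN : nonsingular dot) (hS : strong dot) :
  (globalization dot (AS_act dot) (lambda hU) /\
   generated (AS_act dot) (lambda hU))
  /\
  (forall (B : Type) (op : B -> S -> B) (iota : A -> B),
     globalization dot op iota -> generated op iota ->
     exists! phi : B -> AS dot,
       act_morphism op (AS_act dot) phi /\ lambda hU = phi \o iota).
Proof.
split; first by split; [exact: lambda_globalization | exact: lambda_generated].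
move=> B op iota hG gen; have [opA _ _ G2] := hG.
have [phi phiE] : {phi : B -> AS dot &
    forall b a s, b = op (iota a) s -> phi b = fAS dot a s}.
  (* Quantifying over all representations of [b] builds well-definedness into the chosen [phi]. *)
  apply: (@choice _ _ (fun b f => forall a s, b = op (iota a) s -> f = fAS dot a s)).
  move=> b; have [a [s ->]] := gen b; exists (fAS dot a s) => a' s' E.
  exact/fAS_eq/(globalization_fpmap hG).
exists phi; split; first split.
- move=> b t; have [a [s ->]] := gen b.
  by rewrite (phiE _ a s erefl) AS_act_fAS; apply: phiE; rewrite opA.
- apply/funext => a /=; have [b [s bs]] := hU a.
  by rewrite (lambdaE hU hP hS bs) (phiE _ b s (G2 _ _ _ bs)).
- move=> psi [psiM psi_iota]; apply/funext => b; have [a [s ->]] := gen b.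
  (* Both values at [op (iota a) s] are [lambda hU a] acted on by [s]. *)
  rewrite (phiE _ a s erefl) psiM -(AS_act_lambda hU hP hS).
  by rewrite psi_iota.
Qed.
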